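(* Let $U,\hat U$ be Hilbert spaces, $Q:U\to\hat U$ a bounded linear operator, $w\in\hat U$, $u^{(0)}\in U$, and let $(u^{(n)})_{n\ge0}$ be generated by the conjugate-gradient recurrence $$u^{(n+1)}=u^{(n)}+\alpha_np^{(n)},\qquad r^{(n+1)}=r^{(n)}+\alpha_nQ^*Qp^{(n)},\qquad p^{(n+1)}=-r^{(n+1)}+\beta_np^{(n)},\qquad n\ge0,$$ where $\alpha_n:=\|r^{(n)}\|^2/\|Qp^{(n)}\|^2$ and $\beta_n:=\|r^{(n+1)}\|^2/\|r^{(n)}\|^2$, starting from $-p^{(0)}=r^{(0)}=Q^*(Qu^{(0)}-w)$. Then: (i) if $M_{Q,w}\neq\emptyset$, $u^{(n)}$ converges in norm to $P_{M_{Q,w}}u^{(0)}$; (ii) if $M_{Q,w}=\emptyset$, $\|u^{(n)}\|$ tends to $\infty$.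
   Context: $Q^*$ is the adjoint of $Q$. $M_{Q,w}:=\{u\in U:\|Qu-w\|=\inf_{v\in U}\|Qv-w\|\}$; $P_S$ is the orthogonal projection onto a nonempty closed affine subspace $S$. The iteration is terminated as soon as $r^{(n)}=0$, in which case the sequence is regarded as constant from then on ($u^{(m)}=u^{(n)}$ for $m\ge n$). *)

(* Defs.v *)
From HB Require Import structures.
From mathcomp Require Import all_boot all_order all_algebra.
From mathcomp Require Import all_classical all_reals all_analysis.
From mathcomp Require Import complex.
Import Order.TTheory GRing.Theory Num.Theory.
Import numFieldNormedType.Exports.

Set Implicit Arguments.
Unset Strict Implicit.
Unset Printing Implicit Defensive.

Local Open Scope classical_set_scope.
Local Open Scope ring_scope.

(* The scalar field is R or C, together with its conjugation. *)
Variant real_or_complex (R : realType) : forall K : numFieldType, (K -> K) -> Prop :=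
  | Real_scalars : @real_or_complex R R idfun
  | Complex_scalars : @real_or_complex R R[i] Num.conj.

(* The form is linear in its first argument and theta-linear in the second.
   As for every normed module over K, norms take their values in K; when K is
   R[i], z <= z' means that z' - z is a nonnegative real. *)
HB.mixin Record CompleteNormedModule_isHilbert (K : numFieldType) (theta : K -> K)
    (U : Type) of CompleteNormedModule K U := {
  inner_form : {dot U for theta};
  inner_form_norm : forall u : U, inner_form u u = `|u| ^+ 2
}.

#[short(type="hilbertType")]
HB.structure Definition Hilbert (K : numFieldType) (theta : K -> K) :=
  {U of CompleteNormedModule K U & CompleteNormedModule_isHilbert K theta U}.

Section ConjugateGradient.
Context {K : numFieldType} {theta : K -> K}.

Definition inner {U : hilbertType theta} (u v : U) : K :=
  @inner_form K theta U u v.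

Local Notation "''[' u , v ]" := (inner u v).

(* get picks an element of a set, and is junk on the empty set; here the set is a
   singleton whenever S is a nonempty closed affine subspace. *)
Definition ortho_proj {U : hilbertType theta} (S : set U) (x : U) : U :=
  get [set z | S z /\ forall y, S y -> '[x - z, y - z] = 0].

Context {U V : hilbertType theta}.
Implicit Types (Q : U -> V) (w : V).

(* For a bounded linear Q this z exists by Riesz representation, and is unique. *)
Definition adjoint Q (v : V) : U :=
  get [set z | forall u, '[Q u, v] = '[u, z]].

(* infimums A is the set of greatest lower bounds of A, so that membership says
   that `|Q u - w| is the infimum. *)
Definition least_squares Q w : set U :=
  [set u | infimums [set `|Q v - w| | v in [set: U]] `|Q u - w|].

(* The state is the triple (u, r, p). Once r = 0 the state no longer changes. *)
Definition cg_init Q w (u0 : U) : U * U * U :=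
  let r0 := adjoint Q (Q u0 - w) in (u0, r0, - r0).

Definition cg_step Q (s : U * U * U) : U * U * U :=
  let: (u, r, p) := s in
  if r == 0 then s else
  let alpha := `|r| ^+ 2 / `|Q p| ^+ 2 in
  let r' := r + alpha *: adjoint Q (Q p) in
  let beta := `|r'| ^+ 2 / `|r| ^+ 2 in
  (u + alpha *: p, r', - r' + beta *: p).

Definition cg_iterate Q w (u0 : U) (n : nat) : U :=
  (iter n (cg_step Q) (cg_init Q w u0)).1.1.

End ConjugateGradient.

(* Main.v *)
(* No spectral theory is needed.  The search directions satisfy <p_i, p_j> >= 0
   and the step sizes are nonnegative, hence <u_m - u_0, u_n - u_m> >= 0 and
     |u_m - u_0|^2 + |u_n - u_m|^2 <= |u_n - u_0|^2   for m <= n.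
   So |u_n - u_0| is nondecreasing, and u_n is a Cauchy sequence as soon as it
   is bounded along a subsequence.  One step decreases |Q u_n - w|^2 by at least
   |r_n|^2 / |Q|^2; therefore r_n -> 0 and any limit of u_n satisfies the normal
   equation, that is, lies in M.  This gives (ii).  If x is in M then
   <x - u_n, p_i> >= 0 for i <= n, so <x - u_n, u_n - u_0> >= 0 and
   |u_n - u_0| <= |x - u_0|: the sequence is bounded.  Its limit l is the
   projection of u_0 since l - u_0 is orthogonal to the kernel of Q. *)
Require Import Defs.
From HB Require Import structures.
From mathcomp Require Import all_boot all_order all_algebra.
From mathcomp Require Import all_classical all_reals all_analysis.
From mathcomp Require Import complex ring.
Import Order.TTheory GRing.Theory Num.Theory.
Import numFieldNormedType.Exports.

Set Implicit Arguments.
Unset Strict Implicit.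
Unset Printing Implicit Defensive.

Local Open Scope classical_set_scope.
Local Open Scope ring_scope.

Local Notation "''[' u , v ]" := (inner u v).

(** * Scalars: near minima and conjugation *)

(* Completeness of the reals, in a form that also makes sense in R[i], where only
   the nonnegative elements are used; nonnegativity includes being real. *)
Definition near_minima (K : numFieldType) := forall (A : set K) (e : K),
  A !=set0 -> (forall a, A a -> 0 <= a) -> 0 < e ->
  exists2 a, A a & forall b, A b -> a <= b + e.

Lemma near_minima_real (R : realType) : near_minima R.
Proof.
move=> A e A0 Age0 e0.
have infA : has_inf A by split=> //; exists 0 => a /Age0.
have [a Aa lta] := inf_adherent e0 infA.
exists a => // b Ab; apply: (le_trans (ltW lta)).
by rewrite lerD2r; apply: ge_inf => //; case: infA.
Qed.

(** A nonnegative element of [R[i]] has zero imaginary part, so a near minimum of the real parts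
    serves. *)
Lemma near_minima_complex (R : realType) : near_minima R[i].
Proof.
move=> A e [a0 Aa0] Age0; rewrite ltcE => /andP[/eqP ie re].
have [||_ [a Aa <-] mina] := @near_minima_real R (@complex.Re R @` A) _ _ _ re.
- by exists (complex.Re a0), a0.
- by move=> _ [a /Age0 + <-]; rewrite lecE => /andP[].
exists a => // b Ab; have := mina _ (ex_intro2 _ _ b Ab erefl).
have := Age0 _ Aa; have := Age0 _ Ab; rewrite !lecE.
move: a b e ie {Aa Ab re mina} => [a a'] [b b'] [e e'] /= -> /andP[/eqP -> _].
by move=> /andP[/eqP -> _] ->; rewrite addr0 eqxx.
Qed.

(** This fact, [scalar_conj_norm] and [scalar_near_minima] carry all the later use of the choice of
    scalars, so the real and complex cases run together. *)
Lemma scalar_conj_ge0 (R : realType) (K : numFieldType) (theta : K -> K) :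
  real_or_complex R theta -> forall x, 0 <= x -> theta x = x.
Proof. by case=> // x x0; apply: geC0_conj. Qed.

Lemma scalar_conj_norm (R : realType) (K : numFieldType) (theta : K -> K) :
  real_or_complex R theta -> forall x, x * theta x = `|x| ^+ 2.
Proof.
case=> x; first by rewrite real_normK ?num_real // expr2.
by rewrite normCK.
Qed.

Lemma scalar_near_minima (R : realType) (K : numFieldType) (theta : K -> K) :
  real_or_complex R theta -> near_minima K.
Proof. by case; [apply: near_minima_real|apply: near_minima_complex]. Qed.

Section NearMinima.
Context {K : numFieldType}.
Hypothesis minK : near_minima K.

(** The Archimedean property: if [1/(n+1)] is minimal up to [e/2], comparison with its half
    [1/(2n+2)] gives [1/(n+1) <= e]; a larger index makes this strict. *)
Lemma small_invS (e : K) : 0 < e -> exists n, n.+1%:R^-1 < e.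
Proof.
move=> e0; have e2 : 0 < e / 2 by rewrite divr_gt0.
have [||_ [n _ <-] minn] := minK (A := range (fun n => n.+1%:R^-1)) _ _ e2.
- by exists (0.+1%:R^-1), 0%N.
- by move=> _ [n _ <-]; rewrite invr_ge0.
exists (n.*2.+1).+2; have := minn _ (ex_intro2 _ _ (n.*2.+1) I erefl).
have -> : (n.*2.+2%:R : K)^-1 = n.+1%:R^-1 / 2.
  by rewrite -invfM -natrM muln2.
rewrite -lerBlDl [X in X - _](splitr (n.+1%:R^-1)) addrK.
rewrite ler_pM2r ?invr_gt0//; apply: lt_le_trans.
by rewrite ltf_pV2 ?posrE// ltr_nat -addnn !ltnS -!addnS leq_addr.
Qed.

(** Stands in for monotone convergence: choose [a N] as a near minimum of the range. *)
Lemma nonincreasing_small_drops (a : nat -> K) (e : K) :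
  (forall n, 0 <= a n) -> {homo a : m n / (m <= n)%N >-> n <= m} -> 0 < e ->
  exists N, forall n, (N <= n)%N -> a N - a n <= e.
Proof.
move=> a0 noninc e0; have [||_ [N _ <-] minN] := minK (A := range a) _ _ e0.
- by exists (a 0%N), 0%N.
- by move=> _ [n _ <-].
by exists N => n _; rewrite lerBlDl minN //; exists n.
Qed.

End NearMinima.

(** Squared distances to a single term are what the parallelogram law and the growth of [|u n - u0|]
    provide below. *)
Lemma cvg_of_cauchy_sqr (K : numFieldType) (U : completeNormedModType K)
    (x : nat -> U) :
  (forall e : K, 0 < e ->
    exists N, forall n, (N <= n)%N -> `|x n - x N| ^+ 2 <= e) ->
  cvg (x @ \oo).
Proof.
move=> xC; apply/cauchy_cvgP/cauchy_exP => e e0.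
have e2 : 0 < e / 2 by rewrite divr_gt0.
have [|N xN] := xC ((e / 2) ^+ 2); first by rewrite exprn_gt0.
exists (x N); exists N => // n /= Nn; rewrite -ball_normE /= distrC.
have := xN n Nn; rewrite ler_pXn2r ?nnegrE ?(ltW e2)//.
by move=> /le_lt_trans -> //; rewrite ltr_pdivrMr// ltr_pMr// ltr1n.
Qed.

(** * Hilbert space geometry *)

Section InnerProduct.
Context {K : numFieldType} {theta : K -> K}.
Hypothesis theta_ge0 : forall x, 0 <= x -> theta x = x.
Hypothesis theta_norm : forall x, x * theta x = `|x| ^+ 2.
Context {U : hilbertType theta}.
Implicit Types (u v : U) (a : K).

Lemma innerC u v : '[u, v] = theta '[v, u].
Proof. by rewrite /inner (@hermitian_subproof _ _ false) expr0 mul1r. Qed.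
Lemma innerDl u v (z : U) : '[u + v, z] = '[u, z] + '[v, z].
Proof. exact: linearDl. Qed.
Lemma innerBl u v (z : U) : '[u - v, z] = '[u, z] - '[v, z].
Proof. exact: linearBl. Qed.
Lemma innerNl u v : '[- u, v] = - '[u, v].
Proof. exact: linearNl. Qed.
Lemma inner0l u : '[0, u] = 0 :> K.
Proof. exact: linear0l. Qed.
Lemma innerZl a u v : '[a *: u, v] = a * '[u, v].
Proof. exact: linearZl_LR. Qed.
Lemma innerDr u v (z : U) : '[z, u + v] = '[z, u] + '[z, v].
Proof. exact: linearDr. Qed.
Lemma innerBr u v (z : U) : '[z, u - v] = '[z, u] - '[z, v].
Proof. exact: linearBr. Qed.
Lemma innerNr u v : '[u, - v] = - '[u, v].
Proof. exact: linearNr. Qed.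
Lemma inner0r u : '[u, 0] = 0 :> K.
Proof. exact: linear0r. Qed.
Lemma innerZr a u v : '[u, a *: v] = theta a * '[u, v].
Proof. exact: linearZr_LR. Qed.
Lemma innerZr_ge0 a u v : 0 <= a -> '[u, a *: v] = a * '[u, v].
Proof. by move=> a0; rewrite innerZr theta_ge0. Qed.

Lemma inner_norm u : '[u, u] = `|u| ^+ 2.
Proof. exact: inner_form_norm. Qed.

Lemma inner_eq0C u v : '[u, v] = 0 -> '[v, u] = 0.
Proof. by move=> uv; rewrite innerC uv theta_ge0. Qed.

(** A nonnegative scalar is real, hence fixed by conjugation; sign conditions thus pass from one
    order of the arguments to the other. *)
Lemma inner_ge0C u v : 0 <= '[u, v] -> '[v, u] = '[u, v].
Proof. by move=> uv; rewrite innerC theta_ge0. Qed.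

Lemma inner_self_ge0 u : 0 <= '[u, u].
Proof. by rewrite inner_norm exprn_ge0. Qed.

Lemma inner_self_eq0 u : '[u, u] = 0 -> u = 0.
Proof. by move/eqP; rewrite inner_norm expf_eq0 normr_eq0 => /eqP. Qed.

Lemma sqr_normD u v :
  `|u + v| ^+ 2 = `|u| ^+ 2 + `|v| ^+ 2 + ('[u, v] + '[v, u]) :> K.
Proof. by rewrite -!inner_norm innerDl !innerDr; ring. Qed.

Lemma sqr_normB u v :
  `|u - v| ^+ 2 = `|u| ^+ 2 + `|v| ^+ 2 - ('[u, v] + '[v, u]) :> K.
Proof. by rewrite -!inner_norm innerBl !innerBr; ring. Qed.

Lemma sqr_normD_ge u v : 0 <= '[u, v] -> `|u| ^+ 2 + `|v| ^+ 2 <= `|u + v| ^+ 2.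
Proof. by move=> uv; rewrite sqr_normD lerDl addr_ge0 // (inner_ge0C uv). Qed.

Lemma pythagoras u v : '[u, v] = 0 -> `|u + v| ^+ 2 = `|u| ^+ 2 + `|v| ^+ 2.
Proof. by move=> uv; rewrite sqr_normD uv (inner_eq0C uv) !addr0. Qed.

Lemma parallelogram u v :
  `|u - v| ^+ 2 = (`|u| ^+ 2 + `|v| ^+ 2) *+ 2 - `|u + v| ^+ 2 :> K.
Proof. by rewrite sqr_normB sqr_normD; ring. Qed.

Lemma cauchy_schwarz u v : `|'[u, v]| <= `|u| * `|v|.
Proof.
have [->|v0] := eqVneq v 0; first by rewrite inner0r !normr0 mulr0.
have v2 : 0 < `|v| ^+ 2 by rewrite exprn_gt0 // normr_gt0.
rewrite -(ler_pXn2r (isT : (0 < 2)%N)) ?nnegrE ?mulr_ge0// exprMn.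
rewrite -subr_ge0 -(pmulr_rge0 _ v2).
(* Expand the square of the norm of |v|^2 u - <u, v> v. *)
suff -> : `|v| ^+ 2 * (`|u| ^+ 2 * `|v| ^+ 2 - `|'[u, v]| ^+ 2) =
    `| `|v| ^+ 2 *: u - '[u, v] *: v| ^+ 2 by rewrite exprn_ge0.
rewrite sqr_normB !normrZ !innerZl (innerZr_ge0 _ _ (ltW v2)) innerZr.
rewrite (innerC v u) normr_id !exprMn -(theta_norm '[u, v]).
by rewrite /=; ring.
Qed.

(* Compare z with its component orthogonal to k. *)
Lemma near_ortho_of_near_minimal (z k : U) (e : K) :
  (forall a, `|z| ^+ 2 <= `|z - a *: k| ^+ 2 + e) ->
  `|'[z, k]| ^+ 2 <= e * `|k| ^+ 2.
Proof.
move=> zmin; have [->|k0] := eqVneq k 0.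
  by rewrite inner0r !normr0 expr0n /= mulr0.
have k2 : 0 < `|k| ^+ 2 by rewrite exprn_gt0 // normr_gt0.
have ik2 : 0 <= (`|k| ^+ 2)^-1 by rewrite invr_ge0 ltW.
have := zmin ('[z, k] / `|k| ^+ 2).
have -> : `|z - ('[z, k] / `|k| ^+ 2) *: k| ^+ 2
    = `|z| ^+ 2 - `|'[z, k]| ^+ 2 / `|k| ^+ 2.
  rewrite -scalerA sqr_normB !normrZ innerZl innerZr innerZl.
  rewrite (innerZr_ge0 _ _ ik2) (innerC k z) -(theta_norm '[z, k]).
  rewrite (ger0_norm ik2) !exprMn -(theta_norm '[z, k]).
  by field; rewrite normr_eq0.
by rewrite addrAC lerBrDr lerD2l ler_pdivrMr.
Qed.

End InnerProduct.

Lemma eq0_of_norm_le (K : numFieldType) (V : normedZmodType K) (x : V) :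
  (forall e : K, 0 < e -> `|x| <= e) -> x = 0.
Proof.
move=> xe; apply/eqP; rewrite -normr_le0; apply/negPn/negP => x0.
have {}x0 : 0 < `|x| by move: x0; rewrite normr_le0 normr_gt0.
have := xe (`|x| / 2); rewrite divr_gt0// => /(_ isT).
by rewrite ler_pdivlMr// ger_pMr// lern1.
Qed.

(** * Riesz representation and the adjoint *)

Section Riesz.
Context {K : numFieldType} {theta : K -> K}.
Hypothesis theta_ge0 : forall x, 0 <= x -> theta x = x.
Hypothesis theta_norm : forall x, x * theta x = `|x| ^+ 2.
Hypothesis minK : near_minima K.
Context {U : hilbertType theta}.

Section Functional.
Variables (f : {scalar U}) (C : K).
Hypothesis C0 : 0 < C.
Hypothesis f_le : forall u, `|f u| <= C * `|u|.

Lemma near_minimal_sequence (x : U) : f x = 1 ->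
  exists y : nat -> U, forall n, f (y n) = 1 /\
    forall z, f z = 1 -> `|y n| ^+ 2 <= `|z| ^+ 2 + n.+1%:R^-1.
Proof.
move=> fx; suff /choice[y yP] : forall n : nat, exists y, f y = 1 /\
    forall z, f z = 1 -> `|y| ^+ 2 <= `|z| ^+ 2 + n.+1%:R^-1 by exists y.
move=> n; have [|||_ [y fy <-] miny] := minK
  (A := [set `|y| ^+ 2 | y in [set y | f y = 1]]) (e := n.+1%:R^-1).
- by exists (`|x| ^+ 2), x.
- by move=> _ [y _ <-]; apply: exprn_ge0.
- by rewrite invr_gt0.
by exists y; split=> // z fz; apply: miny; exists z.
Qed.

(** The midpoint of [y n] and [y N] still has [f = 1], so the parallelogram law bounds
    [|y n - y N|^2] by [4/(N+1)]. *)
Lemma near_minimal_cvg (y : nat -> U) :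
  (forall n, f (y n) = 1 /\
    forall z, f z = 1 -> `|y n| ^+ 2 <= `|z| ^+ 2 + n.+1%:R^-1) ->
  cvg (y @ \oo).
Proof.
move=> ymin; apply: cvg_of_cauchy_sqr => e e0.
have [N Ne] := small_invS minK (e := e / 4%:R) (divr_gt0 e0 (ltr0Sn _ _)).
exists N => n Nn; rewrite parallelogram //.
pose m := 2^-1 *: (y n + y N).
have fm : f m = 1.
  by rewrite linearZ linearD /= (ymin n).1 (ymin N).1 -mulr2n mulVf ?pnatr_eq0.
have -> : `|y n + y N| ^+ 2 = 4%:R * `|m| ^+ 2.
  rewrite normrZ ger0_norm ?invr_ge0// exprMn mulrA.
  by rewrite (_ : 4%:R * _ = 1) ?mul1r//; field.
have n_le : n.+1%:R^-1 <= N.+1%:R^-1 :> K.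
  by rewrite lef_pV2 ?posrE// ler_nat.
have yn : `|y n| ^+ 2 <= `|m| ^+ 2 + N.+1%:R^-1.
  by apply: le_trans ((ymin n).2 m fm) _; rewrite lerD2l.
have yN := (ymin N).2 m fm.
rewrite lerBlDr; apply: le_trans (ler_wMn2r 2 (lerD yn yN)) _.
rewrite (_ : (_ + _) *+ 2 = 4%:R * N.+1%:R^-1 + 4%:R * `|m| ^+ 2); last by ring.
by rewrite lerD2r -ler_pdivlMl// mulrC ltW.
Qed.

(* The minimal-norm element l of {f = 1} is orthogonal to the kernel of f, so f
   is represented by l / |l|^2. *)
Lemma riesz : exists z, forall u, f u = '[u, z].
Proof.
have [f0|/existsNP[x0 /eqP fx0]] := pselect (forall u, f u = 0).
  by exists 0 => u; rewrite f0 inner0r.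
have [|y ymin] := @near_minimal_sequence ((f x0)^-1 *: x0).
  by rewrite linearZ /= mulVf.
pose l := lim (y @ \oo).
have /cvgrPdist_lt yl : y @ \oo --> l by apply: near_minimal_cvg.
have fl : f l = 1.
  apply/eqP; rewrite -subr_eq0; apply/eqP; apply: eq0_of_norm_le => e e0.
  have [N _ /(_ N (leqnn N)) /= lN] := yl _ (divr_gt0 e0 C0).
  rewrite -(ymin N).1 -linearB /=; apply: le_trans (f_le _) _.
  by rewrite -ler_pdivlMl// mulrC ltW.
(* Split [l] into [l - y n], small by convergence, and [y n], nearly orthogonal to [k] since moving
   along [k] keeps [f = 1]. Each part gets [e/2]; [|k| + 1] avoids dividing by zero. *)
have orth k : f k = 0 -> '[k, l] = 0.
  move=> fk; apply: inner_eq0C => //; apply: eq0_of_norm_le => e e0.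
  have k1 : 0 < `|k| + 1 by rewrite ltr_wpDl.
  have e2 : 0 < e / 2 by rewrite divr_gt0.
  have d0 := divr_gt0 e2 k1.
  have [N _ lN] := yl _ d0.
  have [M Me] := small_invS minK (exprn_gt0 2 d0).
  have {lN} := lN _ (leq_maxl N M); set n := maxn N M => /ltW /= ln.
  have kk : `|k| <= `|k| + 1 by rewrite lerDl.
  rewrite -[l](subrK (y n)) innerDl (splitr e).
  apply: le_trans (ler_normD _ _) (lerD _ _).
    apply: le_trans (cauchy_schwarz theta_ge0 theta_norm _ _) _.
    apply: le_trans (ler_pM _ _ ln kk) _ => //.
    by rewrite divfK ?gt_eqF.
  rewrite -(ler_pXn2r (isT : (0 < 2)%N)) ?nnegrE// ?(ltW e2)//.
  have : `|'[y n, k]| ^+ 2 <= n.+1%:R^-1 * `|k| ^+ 2.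
    apply: near_ortho_of_near_minimal => // a; apply: (ymin n).2.
    by rewrite linearB linearZ /= fk mulr0 subr0 (ymin n).1.
  move/le_trans; apply.
  rewrite -[X in _ <= X ^+ 2](divfK (lt0r_neq0 k1)) exprMn.
  apply: ler_pM; rewrite ?invr_ge0 ?exprn_ge0//.
    apply: le_trans (ltW Me); rewrite lef_pV2 ?posrE// ler_nat ltnS.
    exact: leq_maxr.
  by rewrite ler_pXn2r ?nnegrE// (ltW k1).
have l0 : `|l| ^+ 2 != 0.
  rewrite expf_eq0 /= normr_eq0; apply/eqP => l0.
  by move: fl; rewrite l0 linear0 => /eqP; rewrite eq_sym oner_eq0.
exists ((`|l| ^+ 2)^-1 *: l) => u.
rewrite innerZr_ge0 ?invr_ge0 ?exprn_ge0//.
have /orth/eqP : f (u - f u *: l) = 0.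
  by rewrite linearB linearZ /= fl mulr1 subrr.
rewrite innerBl innerZl inner_norm subr_eq0 => /eqP ->.
by rewrite mulrCA mulVf ?mulr1.
Qed.

End Functional.

Context {V : hilbertType theta}.
Variables (Q : {linear U -> V}) (C : K).
Hypothesis C0 : 0 < C.
Hypothesis Q_le : forall u, `|Q u| <= C * `|u|.

(** Riesz representation of [u |-> '[Q u, v]] shows that the set from which [adjoint] picks is
    nonempty. *)
Lemma adjointE v u : '[Q u, v] = '[u, adjoint Q v].
Proof.
move: u; have lin : linear_for *%R (fun u => '[Q u, v]).
  by move=> a x y /=; rewrite linearP innerDl innerZl.
pose f : {scalar U} := HB.pack (fun u => '[Q u, v])
  (GRing.isLinear.Build _ _ _ _ _ lin).
(* The added 1 keeps the bound positive when [v = 0]. *)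
have [|u|z fz] := @riesz f (C * (`|v| + 1)).
- by rewrite mulr_gt0 // ltr_wpDl.
- apply: le_trans (cauchy_schwarz theta_ge0 theta_norm _ _) _.
  by rewrite mulrAC ler_pM// lerDl.
by apply: (@getPex _ [set z | forall u, '[Q u, v] = '[u, z]]); exists z.
Qed.

End Riesz.

(** * The normal equation and the conjugate-gradient recurrences *)

Section ConjugateGradient.
Context {K : numFieldType} {theta : K -> K}.
Hypothesis theta_ge0 : forall x, 0 <= x -> theta x = x.
Hypothesis theta_norm : forall x, x * theta x = `|x| ^+ 2.
Hypothesis minK : near_minima K.
Context {U V : hilbertType theta}.
Variables (Q : {linear U -> V}) (C : K) (w : V) (u0 : U).
Hypothesis C0 : 0 < C.
Hypothesis Q_le : forall u, `|Q u| <= C * `|u|.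

(** The normal equation. An exact minimiser is a near minimiser with error 0, hence orthogonal to
    every [Q y]; the converse is Pythagoras. *)
Lemma least_squaresP u :
  least_squares Q w u <-> forall y, '[Q y, Q u - w] = 0.
Proof.
split=> [[ulb _] y | ortho].
  apply: inner_eq0C => //; apply/eqP; rewrite -normr_eq0 -sqrf_eq0.
  rewrite eq_le exprn_ge0 // andbT -(mul0r (`|Q y| ^+ 2)).
  apply: near_ortho_of_near_minimal => // a.
  have -> : Q u - w - a *: Q y = Q (u - a *: y) - w.
    by rewrite [in RHS]linearB [Q (a *: y)]linearZ /= addrAC.
  rewrite addr0 ler_pXn2r ?nnegrE//; apply: ulb.
  by exists (u - a *: y).
split=> [_ [v _ <-]|b blb]; last by apply: blb; exists u.
rewrite -(ler_pXn2r (isT : (0 < 2)%N)) ?nnegrE//.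
have -> : Q v - w = Q (v - u) + (Q u - w) by rewrite linearB addrA subrK.
by rewrite (pythagoras theta_ge0 (ortho _)) lerDr exprn_ge0.
Qed.

(* cg_step without the stopping test: once r = 0, the junk value x / 0 = 0 makes
   alpha, r and the next p vanish, so that u stays constant all the same. *)
Definition cg_update (s : U * U * U) : U * U * U :=
  let: (u, r, p) := s in
  let alpha := `|r| ^+ 2 / `|Q p| ^+ 2 in
  let r' := r + alpha *: adjoint Q (Q p) in
  let beta := `|r'| ^+ 2 / `|r| ^+ 2 in
  (u + alpha *: p, r', - r' + beta *: p).

Definition cg_state n := iter n cg_update (cg_init Q w u0).

Local Notation u n := (cg_state n).1.1.
Local Notation r n := (cg_state n).1.2.
Local Notation p n := (cg_state n).2.
Local Notation alpha n := (`|r n| ^+ 2 / `|Q (p n)| ^+ 2).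
Local Notation beta n := (`|r n.+1| ^+ 2 / `|r n| ^+ 2).

Lemma cg_iterateE n : cg_iterate Q w u0 n = u n.
Proof.
(* Equality of [p] is only demanded while [r n != 0]; afterwards both updates fix [u] and [r]
   whatever [p] is. *)
rewrite /cg_iterate; suff [-> //] :
  (iter n (cg_step Q) (cg_init Q w u0)).1 = (cg_state n).1 /\
  (r n != 0 -> iter n (cg_step Q) (cg_init Q w u0) = cg_state n).
elim: n => // n [IH1 IH2]; rewrite /cg_state !iterS -/(cg_state n).
move: IH1 IH2; case: (cg_state n) => -[un rn] pn /=.
case: (iter n _ _) => -[un' rn'] pn' /= [-> ->].
have [-> _|rn0 /(_ isT)[->]] := eqVneq rn 0; last by [].
by rewrite /cg_step /cg_update normr0 expr0n !mul0r !scale0r !addr0 eqxx.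
Qed.

Lemma cg_u0 : u 0%N = u0. Proof. by []. Qed.

Lemma cg_uS n : u n.+1 = u n + alpha n *: p n.
Proof. by rewrite /cg_state iterS; case: (iter n _ _) => -[]. Qed.

Lemma cg_rS n : r n.+1 = r n + alpha n *: adjoint Q (Q (p n)).
Proof. by rewrite /cg_state iterS; case: (iter n _ _) => -[]. Qed.

Lemma cg_p0 : p 0%N = - r 0%N. Proof. by []. Qed.

Lemma cg_pS n : p n.+1 = - r n.+1 + beta n *: p n.
Proof. by rewrite /cg_state iterS; case: (iter n _ _) => -[]. Qed.

Lemma cg_alpha_ge0 n : 0 <= alpha n.
Proof. by rewrite divr_ge0 ?exprn_ge0. Qed.

Lemma cg_beta_ge0 n : 0 <= beta n.
Proof. by rewrite divr_ge0 ?exprn_ge0. Qed.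

Lemma inner_rS y n : '[y, r n.+1] = '[y, r n] + alpha n * '[Q y, Q (p n)].
Proof.
by rewrite cg_rS innerDr innerZr_ge0 ?cg_alpha_ge0// (adjointE _ _ _ C0 Q_le).
Qed.

(** Weak form of [r n] being the adjoint applied to [Q (u n) - w]: the update of [r] mirrors that of
    [u]. *)
Lemma inner_residual y n : '[y, r n] = '[Q y, Q (u n) - w].
Proof.
elim: n => [|n IH]; first by rewrite -(adjointE _ _ _ C0 Q_le).
rewrite inner_rS IH cg_uS linearD linearZ /= addrAC [in RHS]innerDr.
by rewrite innerZr_ge0 ?cg_alpha_ge0.
Qed.

Lemma inner_pS x n : '[x, p n.+1] = - '[x, r n.+1] + beta n * '[x, p n].
Proof. by rewrite cg_pS innerDr innerNr innerZr_ge0 ?cg_beta_ge0. Qed.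

Lemma cg_p_eq0 n : r n = 0 -> p n = 0.
Proof.
case: n => [|n] r0; first by rewrite cg_p0 r0 oppr0.
by rewrite cg_pS r0 normr0 expr0n mul0r scale0r addr0 oppr0.
Qed.

(** Either [r n = 0], and then [p n = 0], or the denominator vanishes. *)
Lemma cg_alpha_eq0 n : alpha n = 0 -> Q (p n) = 0.
Proof.
move/eqP; rewrite mulf_eq0 invr_eq0 !sqrf_eq0 !normr_eq0 => /orP[] /eqP //.
by move/cg_p_eq0 ->; rewrite linear0.
Qed.

(** * Orthogonality of residuals and conjugacy of directions *)

(** When [Q (p n) = 0] the quotient is the default 0, but then ['[r n, p n] = 0], so [r n = 0] and
    both sides vanish. *)
Lemma cg_alphaM n : '[r n, p n] = - `|r n| ^+ 2 ->
  alpha n * `|Q (p n)| ^+ 2 = `|r n| ^+ 2.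
Proof.
move=> rp; have [Qp0|Qp0] := eqVneq (Q (p n)) 0; last first.
  by rewrite divfK // sqrf_eq0 normr_eq0.
have : '[p n, r n] = 0 by rewrite inner_residual Qp0 inner0l.
move/(inner_eq0C theta_ge0)/eqP; rewrite rp oppr_eq0 => /eqP ->.
by rewrite !mul0r.
Qed.

Lemma cg_ortho n : [/\ '[r n, p n] = - `|r n| ^+ 2,
  forall i, (i < n)%N -> '[r n, p i] = 0 &
  forall i, (i < n)%N -> '[Q (p n), Q (p i)] = 0].
Proof.
elim: n => [|n [rpn rp QpQp]].
  by split=> //; rewrite cg_p0 innerNr inner_norm.
have aQ := cg_alphaM rpn.
have prn : '[- p n, r n] = `|r n| ^+ 2.
  have rNp : '[r n, - p n] = `|r n| ^+ 2 by rewrite innerNr rpn opprK.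
  by rewrite inner_ge0C // rNp exprn_ge0.
have rpS i : (i <= n)%N -> '[r n.+1, p i] = 0.
  move=> lein; apply: inner_eq0C => //; rewrite inner_rS.
  move: lein; rewrite leq_eqVlt => /orP[/eqP ->|ltin].
    by rewrite inner_norm aQ -[X in '[X, _]]opprK innerNl prn addNr.
  rewrite (inner_eq0C theta_ge0 (rp _ ltin)) add0r.
  by rewrite (inner_eq0C theta_ge0 (QpQp _ ltin)) mulr0.
(* Each [r i] is a combination of [p i] and, for [i > 0], its predecessor. *)
have rrS i : (i <= n)%N -> '[r n.+1, r i] = 0.
  case: i => [|i] lein.
    by apply/eqP; rewrite -oppr_eq0 -innerNr -cg_p0 rpS.
  have /esym/eqP := inner_pS (r n.+1) i.
  by rewrite (rpS i.+1 lein) (rpS i (ltnW lein)) mulr0 addr0 oppr_eq0 => /eqP.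
split=> [|i|i]; rewrite ?ltnS.
- by rewrite inner_pS rpS // mulr0 addr0 inner_norm.
- exact: rpS.
(* Multiplying by [alpha i] turns ['[Q (r n.+1), Q (p i)]] into ['[r n.+1, r i.+1]]. For [i = n] the
   choice of [beta n] cancels it; for [i < n] both terms vanish. *)
move=> lein; have [a0|a0] := eqVneq (alpha i) 0.
  by rewrite (cg_alpha_eq0 a0) inner0r.
apply: (mulfI a0); rewrite mulr0.
rewrite cg_pS linearD linearN linearZ /= innerDl innerNl innerZl mulrDr mulrN.
have -> : alpha i * '[Q (r n.+1), Q (p i)] = '[r n.+1, r i.+1].
  by rewrite inner_rS rrS // add0r.
move: lein; rewrite leq_eqVlt => /orP[/eqP ein|ltin].
  rewrite ein in a0 *; rewrite !inner_norm mulrCA aQ divfK ?addNr//.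
  by apply: contraNneq a0 => ->; rewrite mul0r.
by rewrite rrS // QpQp // !mulr0 oppr0 addr0.
Qed.

Lemma inner_rp n : '[r n, p n] = - `|r n| ^+ 2.
Proof. by have [] := cg_ortho n. Qed.

Lemma inner_rp_eq0 n i : (i < n)%N -> '[r n, p i] = 0.
Proof. by have [_ + _] := cg_ortho n; apply. Qed.

Lemma inner_QpQp_eq0 n i : (i < n)%N -> '[Q (p n), Q (p i)] = 0.
Proof. by have [_ _] := cg_ortho n; apply. Qed.

(** * Growth of the distance from [u0] *)

(** [u n - u m] is the sum of the [alpha i *: p i] for [m <= i < n]; in the companion lemma on
    signs, [alpha i >= 0] is what matters. *)
Lemma inner_path_eq0 x m n : (m <= n)%N ->
  (forall i, (m <= i < n)%N -> '[x, p i] = 0) -> '[x, u n - u m] = 0.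
Proof.
elim: n => [|n IH]; first by rewrite leqn0 => /eqP -> _; rewrite subrr inner0r.
rewrite leq_eqVlt => /orP[/eqP <- _|]; first by rewrite subrr inner0r.
rewrite ltnS => lemn xp.
rewrite cg_uS addrAC innerDr innerZr_ge0 ?cg_alpha_ge0//.
rewrite xp ?lemn ?ltnSn// mulr0 addr0; apply: IH => // i /andP[mi ltin].
by rewrite xp // mi ltnS ltnW.
Qed.

Lemma inner_path_ge0 x m n : (m <= n)%N ->
  (forall i, (m <= i < n)%N -> 0 <= '[x, p i]) -> 0 <= '[x, u n - u m].
Proof.
elim: n => [|n IH]; first by rewrite leqn0 => /eqP -> _; rewrite subrr inner0r.
rewrite leq_eqVlt => /orP[/eqP <- _|]; first by rewrite subrr inner0r.
rewrite ltnS => lemn xp.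
rewrite cg_uS addrAC innerDr innerZr_ge0 ?cg_alpha_ge0//.
apply: addr_ge0; last by rewrite mulr_ge0 ?cg_alpha_ge0 ?xp ?lemn ?ltnSn.
by apply: IH => // i /andP[mi ltin]; rewrite xp // mi ltnS ltnW.
Qed.

(** Against an earlier direction the residual part of [p j.+1] contributes 0, and [beta j >= 0]
    preserves the sign. *)
Lemma inner_pp_ge0 i j : 0 <= '[p i, p j].
Proof.
wlog leij : i j / (i <= j)%N => [sym|].
  have [/sym//|/ltnW/sym pji] := leqP i j.
  by rewrite (inner_ge0C theta_ge0 pji).
elim: j leij => [|j IH].
  by rewrite leqn0 => /eqP ->; apply: inner_self_ge0.
rewrite leq_eqVlt => /orP[/eqP ->|leij]; first exact: inner_self_ge0.
rewrite inner_pS (inner_eq0C theta_ge0 (inner_rp_eq0 leij)) oppr0 add0r.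
by rewrite mulr_ge0 ?cg_beta_ge0 ?IH.
Qed.

Lemma cg_increment_sqr m n : (m <= n)%N ->
  `|u m - u0| ^+ 2 + `|u n - u m| ^+ 2 <= `|u n - u0| ^+ 2.
Proof.
move=> lemn; have -> : u n - u0 = (u m - u0) + (u n - u m).
  by rewrite [RHS]addrC addrA subrK.
apply: sqr_normD_ge => //; apply: inner_path_ge0 => // i _.
suff up : 0 <= '[p i, u m - u0] by rewrite (inner_ge0C theta_ge0 up).
by rewrite -cg_u0; apply: inner_path_ge0 => // j _; apply: inner_pp_ge0.
Qed.

Lemma cg_bounded_cvg (B : K) : (forall n, `|u n - u0| ^+ 2 <= B) ->
  cvg ((fun n => u n) @ \oo).
Proof.
move=> uB; apply: cvg_of_cauchy_sqr => e e0.
(* The gap between [|u n - u0|^2] and [B] is nonincreasing, and its drop from [N] to [n] dominates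
   [|u n - u N|^2]. *)
have [|m n lemn|N drop] := @nonincreasing_small_drops _ minK
    (fun n => B - `|u n - u0| ^+ 2) e _ _ e0.
- by move=> n; rewrite subr_ge0.
- rewrite lerD2l lerN2; apply: le_trans (cg_increment_sqr lemn).
  by rewrite lerDl exprn_ge0.
exists N => n Nn; apply: le_trans (drop n Nn) => /=.
rewrite opprB [leRHS]addrC addrA subrK lerBrDl.
exact: cg_increment_sqr.
Qed.

(** * Energy decay and vanishing residuals *)

Lemma cg_energy n :
  `|Q (u n.+1) - w| ^+ 2 = `|Q (u n) - w| ^+ 2 - alpha n * `|r n| ^+ 2.
Proof.
(* Using [- p n] makes the inner products nonnegative, hence symmetric. The cross terms then give
   [- 2 alpha |r|^2] and the square [alpha^2 |Q p|^2 = alpha |r|^2]. *)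
have rNp : '[r n, - p n] = `|r n| ^+ 2 by rewrite innerNr inner_rp opprK.
have Npr : '[- p n, r n] = `|r n| ^+ 2.
  by rewrite inner_ge0C // rNp exprn_ge0.
have Qpe : '[Q (- p n), Q (u n) - w] = `|r n| ^+ 2 by rewrite -inner_residual.
have eQp : '[Q (u n) - w, Q (- p n)] = `|r n| ^+ 2.
  by rewrite inner_ge0C // Qpe exprn_ge0.
have -> : Q (u n.+1) - w = Q (u n) - w - alpha n *: Q (- p n).
  by rewrite cg_uS linearD linearN linearZ /= scalerN opprK addrAC.
rewrite sqr_normB innerZl innerZr_ge0 ?cg_alpha_ge0// Qpe eQp.
rewrite normrZ ger0_norm ?cg_alpha_ge0// linearN normrN exprMn.
move: (cg_alphaM (inner_rp n)); move: (alpha n) => a aQ.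
by rewrite [a ^+ 2]expr2 -[a * a * _]mulrA aQ opprD addrA addrK.
Qed.

(** By conjugacy [Q (r n.+1)] is, up to sign, an orthogonal sum of [Q (p n.+1)] and a multiple of
    [Q (p n)]; hence [|Q p| <= |Q r|]. *)
Lemma norm_Qp_le n : `|Q (p n)| ^+ 2 <= C ^+ 2 * `|r n| ^+ 2.
Proof.
apply: (@le_trans _ _ (`|Q (r n)| ^+ 2)); last first.
  by rewrite -exprMn ler_pXn2r ?nnegrE ?mulr_ge0 ?(ltW C0).
case: n => [|n]; first by rewrite cg_p0 linearN normrN.
have -> : `|Q (r n.+1)| = `|Q (p n.+1) - beta n *: Q (p n)|.
  by rewrite cg_pS linearD linearN linearZ /= addrK normrN.
rewrite pythagoras ?lerDl ?exprn_ge0//.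
by rewrite innerNr innerZr_ge0 ?cg_beta_ge0// inner_QpQp_eq0 // mulr0 oppr0.
Qed.

(** [|r|^2 = alpha |Q p|^2 <= C^2 alpha |r|^2], and [alpha |r|^2] is the energy drop. *)
Lemma residual_le_drop n :
  `|r n| ^+ 2 <= C ^+ 2 * (`|Q (u n) - w| ^+ 2 - `|Q (u n.+1) - w| ^+ 2).
Proof.
rewrite cg_energy opprB addrCA subrr addr0 mulrCA.
rewrite -[leLHS](cg_alphaM (inner_rp n)).
by apply: ler_wpM2l; [apply: cg_alpha_ge0|apply: norm_Qp_le].
Qed.

Lemma cg_energy_noninc m n : (m <= n)%N ->
  `|Q (u n) - w| ^+ 2 <= `|Q (u m) - w| ^+ 2.
Proof.
elim: n => [|n IH]; first by rewrite leqn0 => /eqP ->.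
rewrite leq_eqVlt => /orP[/eqP -> //|/IH]; apply: le_trans.
by rewrite cg_energy gerBl mulr_ge0 ?cg_alpha_ge0 ?exprn_ge0.
Qed.

Lemma residual_small (e : K) : 0 < e ->
  exists N, forall n, (N <= n)%N -> `|r n| <= e.
Proof.
move=> e0; have C2 : 0 < C ^+ 2 by rewrite exprn_gt0.
have [|||N drop] := @nonincreasing_small_drops _ minK
    (fun n => `|Q (u n) - w| ^+ 2) (e ^+ 2 / C ^+ 2).
- by move=> n; rewrite exprn_ge0.
- exact: cg_energy_noninc.
- by rewrite divr_gt0 // exprn_gt0.
exists N => n Nn; rewrite -(ler_pXn2r (isT : (0 < 2)%N)) ?nnegrE ?(ltW e0)//.
apply: le_trans (residual_le_drop n) _; rewrite -ler_pdivlMl// mulrC.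
apply: le_trans (drop _ (leq_trans Nn (leqnSn n))); rewrite lerD2r.
exact: cg_energy_noninc.
Qed.

(** * Limits, boundedness and the projection *)

Lemma cg_limit_least_squares (l : U) :
  (fun n => u n) @ \oo --> l -> least_squares Q w l.
Proof.
move=> /cvgrPdist_le ul; apply/least_squaresP => y.
apply: eq0_of_norm_le => e e0.
(* The error is at most [|Q y| C d] from [Q (l - u n)] plus [|y| d] from ['[y, r n]]; the 1 keeps
   the divisor positive. *)
have D0 : 0 < `|Q y| * C + `|y| + 1.
  by rewrite ltr_wpDl// addr_ge0// mulr_ge0// ltW.
have d0 := divr_gt0 e0 D0; set d := _ / _ in d0.
have [N _ lN] := ul _ d0; have [M rM] := residual_small d0.
have {lN} /= := lN _ (leq_maxl N M); have {rM} := rM _ (leq_maxr N M).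
set n := maxn N M => rn ln.
have -> : Q l - w = Q (l - u n) + (Q (u n) - w) by rewrite linearB addrA subrK.
rewrite innerDr -inner_residual.
have Qln : `|Q (l - u n)| <= C * d.
  by apply: le_trans (Q_le _) _; rewrite ler_pM2l.
apply: (@le_trans _ _ (`|Q y| * (C * d) + `|y| * d)).
  apply: le_trans (ler_normD _ _) (lerD _ _).
    apply: le_trans (cauchy_schwarz theta_ge0 theta_norm _ _) _.
    exact: ler_wpM2l.
  apply: le_trans (cauchy_schwarz theta_ge0 theta_norm _ _) _.
  exact: ler_wpM2l.
rewrite mulrA -mulrDl -[leRHS](divfK (lt0r_neq0 D0)) -/d [leRHS]mulrC.
by rewrite ler_pM2r // lerDl.
Qed.

(** ['[x - u n, r j]] has the same value [- |Q (x - u n)|^2] for all [j <= n], so every step of the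
    recurrence for [p] adds a nonnegative amount. *)
Lemma least_squares_sub_ge0 (x : U) i n : least_squares Q w x -> (i <= n)%N ->
  0 <= '[x - u n, p i].
Proof.
move=> /least_squaresP xM; have Qyx y : '[Q y, Q (x - u n)] = - '[y, r n].
  rewrite inner_residual linearB -[Q x](subrK w) -addrA innerDr xM add0r.
  by rewrite -innerNr opprB.
have xr j : (j <= n)%N -> '[x - u n, r j] = - `|Q (x - u n)| ^+ 2.
  move=> lejn; rewrite inner_residual.
  (* [Q x - w] is orthogonal to the range of [Q], and [Q (u n - u j)] to [Q (x - u n)] because [r n]
     is orthogonal to all earlier directions. *)
  have -> : Q (u j) - w = (Q x - w) - (Q (u n - u j) + Q (x - u n)).
    rewrite -linearD [_ + (x - _)]addrC subrKA [Q (x - _)]linearB opprB.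
    by rewrite [RHS]addrC subrKA.
  rewrite innerBr xM sub0r innerDr inner_norm.
  rewrite [X in - (X + _)](_ : _ = 0) ?add0r//; apply: inner_eq0C => //.
  rewrite Qyx; apply/eqP; rewrite oppr_eq0; apply/eqP; apply: inner_eq0C => //.
  by apply: inner_path_eq0 => // k /andP[_ ltkn]; apply: inner_rp_eq0.
elim: i => [|i IH] lein.
  by rewrite cg_p0 innerNr xr // opprK exprn_ge0.
rewrite inner_pS xr // opprK addr_ge0 ?exprn_ge0//.
by rewrite mulr_ge0 ?cg_beta_ge0 ?IH 1?ltnW.
Qed.

Lemma cg_dist_le (x : U) n : least_squares Q w x ->
  `|u n - u0| ^+ 2 <= `|x - u0| ^+ 2.
Proof.
move=> xM; have -> : x - u0 = (x - u n) + (u n - u0) by rewrite addrA subrK.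
apply: le_trans (sqr_normD_ge theta_ge0 _); first by rewrite lerDr exprn_ge0.
rewrite -cg_u0; apply: inner_path_ge0 => // i /andP[_ ltin].
by apply: least_squares_sub_ge0 => //; apply: ltnW.
Qed.

(** A kernel vector is orthogonal to every residual, hence to every direction. *)
Lemma cg_increment_ker (k : U) n : Q k = 0 -> '[k, u n - u0] = 0.
Proof.
move=> Qk; have rk i : '[k, r i] = 0 by rewrite inner_residual Qk inner0l.
rewrite -cg_u0; apply: inner_path_eq0 => // i _.
elim: i => [|i IH]; first by rewrite cg_p0 innerNr rk oppr0.
by rewrite inner_pS rk IH oppr0 mulr0 addr0.
Qed.

Lemma cg_limit_ker (k l : U) : (fun n => u n) @ \oo --> l -> Q k = 0 ->
  '[k, l - u0] = 0.
Proof.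
move=> /cvgrPdist_le ul Qk; apply: eq0_of_norm_le => e e0.
have k1 : 0 < `|k| + 1 by rewrite ltr_wpDl.
have [N _ /(_ N (leqnn N)) /= lN] := ul _ (divr_gt0 e0 k1).
have -> : l - u0 = (l - u N) + (u N - u0) by rewrite addrA subrK.
rewrite innerDr (cg_increment_ker _ Qk) addr0.
apply: le_trans (cauchy_schwarz theta_ge0 theta_norm _ _) _.
rewrite -[X in _ <= X](divfK (lt0r_neq0 k1)) mulrC.
by apply: ler_pM => //; rewrite lerDl.
Qed.

Lemma cg_limit_ortho_proj (l : U) : (fun n => u n) @ \oo --> l ->
  ortho_proj (least_squares Q w) u0 = l.
Proof.
move=> ul; have lM := cg_limit_least_squares ul.
(* Two least-squares solutions differ by a kernel vector, so [cg_limit_ker] yields the defining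
   relation of the projection for [l]. *)
have Qeq x y : least_squares Q w x -> least_squares Q w y -> Q (x - y) = 0.
  move=> /least_squaresP xM /least_squaresP yM; apply: inner_self_eq0.
  rewrite [X in '[_, X]](_ : _ = (Q x - w) - (Q y - w)).
    by rewrite innerBr xM yM subrr.
  by rewrite linearB opprB subrKA.
have l_proj y : least_squares Q w y -> '[u0 - l, y - l] = 0.
  move=> yM; apply: inner_eq0C => //; rewrite -[u0 - l]opprB innerNr.
  by rewrite (cg_limit_ker ul) ?oppr0// Qeq.
have [|zM z_proj] := @getPex _ [set z | least_squares Q w z /\
    forall y, least_squares Q w y -> '[u0 - z, y - z] = 0]; first by exists l.
rewrite -/(ortho_proj _ _) in zM z_proj *.
set z := ortho_proj _ _ in zM z_proj *.
apply/eqP; rewrite -subr_eq0; apply/eqP; apply: inner_self_eq0.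
(* Uniqueness: testing the relation of [l] at [z] and that of [z] at [l] gives [|z - l|^2 = 0]. *)
have -> : '[z - l, z - l] = '[u0 - l, z - l] + '[u0 - z, l - z].
  rewrite -[l - z]opprB innerNr -innerBl; congr ('[_, _]).
  by rewrite opprB [RHS]addrC subrKA.
by rewrite l_proj // z_proj // addr0.
Qed.

(** Otherwise [|u n| <= A] infinitely often, [A] being real and so comparable with norms. Growth of
    [|u n - u0|] bounds the whole sequence, and its limit would lie in the empty set. *)
Lemma cg_norm_pinfty : least_squares Q w = set0 ->
  `|u n| @[n --> \oo] --> +oo.
Proof.
move=> M0 P [A [Areal AP]]; apply: contrapT => notP.
have frequently_le N : exists2 n, (N <= n)%N & `|u n| <= A.
  apply: contrapT => /forall2NP noN; apply: notP; exists N => // n /= Nn.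
  apply: AP; rewrite real_ltNge ?normr_real//; apply/negP => unA.
  by have [] := noN n.
have /cvg_ex[l ul] : cvg ((fun n => u n) @ \oo).
  apply: (@cg_bounded_cvg ((A + `|u0|) ^+ 2)) => N.
  have [n Nn unA] := frequently_le N.
  apply: (@le_trans _ _ (`|u n - u0| ^+ 2)).
    by apply: le_trans (cg_increment_sqr Nn); rewrite lerDl exprn_ge0.
  have unA0 : `|u n - u0| <= A + `|u0|.
    by apply: le_trans (ler_normB _ _) _; rewrite lerD2r.
  by rewrite ler_pXn2r ?nnegrE// (le_trans _ unA0).
by have := cg_limit_least_squares ul; rewrite M0.
Qed.

End ConjugateGradient.

(** * Both alternatives over either scalar field *)

Theorem corollary7p4 (R : realType) (K : numFieldType) (theta : K -> K)
    (scalarsK : real_or_complex R theta) (U V : hilbertType theta)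
    (Q : {linear U -> V}) (Q_bounded : bounded_near Q (nbhs (0 : U)))
    (w : V) (u0 : U) :
  (least_squares Q w !=set0 ->
    cg_iterate Q w u0 @ \oo --> ortho_proj (least_squares Q w) u0) /\
  (least_squares Q w = set0 ->
    `|cg_iterate Q w u0 n| @[n --> \oo] --> +oo).
Proof.
have t0 := scalar_conj_ge0 scalarsK; have tn := scalar_conj_norm scalarsK.
have minK := scalar_near_minima scalarsK.
have [C C0 Q_le] := pinfty_ex_gt0 ((linear_boundedP Q).1 Q_bounded).
have -> : cg_iterate Q w u0 = fun n => (cg_state Q w u0 n).1.1.
  by apply/funext => n; apply: cg_iterateE.
split=> [[x xM]|]; last by apply: cg_norm_pinfty C0 Q_le.
have /cvg_ex[l ul] : cvg ((fun n => (cg_state Q w u0 n).1.1) @ \oo).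
  apply: (cg_bounded_cvg t0 tn minK C0 Q_le) => n.
  exact: (cg_dist_le t0 tn minK u0 C0 Q_le n xM).
by rewrite (cg_limit_ortho_proj t0 tn minK C0 Q_le ul).
Qed.
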